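(* Let $K\ge2$, $\mu\in\mathcal G^*$ with unique optimal arm $a^*$, $\Delta_a=\mu_{a^*}-\mu_a$, $\Delta_{\min}=\min_{a\ne a^*}\Delta_a$, $w=w(\mu)$, $T=T(\mu)$. Let $r$ be the unique solution in $(1/\Delta_{\min}^2,+\infty)$ of $$\phi_\mu(r):=\sum_{a\ne a^*}\frac1{(r\Delta_a^2-1)^2}-1=0 .$$ Then $$w_{a^*}=\frac1{1+\sum_{a\ne a^*}\frac1{r\Delta_a^2-1}},\qquad w_a=\frac{w_{a^*}}{r\Delta_a^2-1}\ \text{ for all }a\ne a^*,\qquad T=\frac{2r}{w_{a^*}},$$ and moreover $$w_{a^*}=\sqrt{\sum_{a\ne a^*}w_a^2}\,.$$
   Context: $\mathcal G^*$ is the set of vectors $\mu\in[0,1]^K$ whose maximal coordinate is attained at a unique index $a^*(\mu)$ (the optimal arm). $\Sigma_K=\{v\in[0,1]^K:\sum_av_a=1\}$. For $\mu\in\mathcal G^*$ with $a^*=a^*(\mu)$, the characteristic time $T(\mu)$ is defined by $$T(\mu)^{-1}=\sup_{v\in\Sigma_K}\inf_{\lambda\in\mathcal G^*:\,a^*(\lambda)\ne a^*}\sum_{a=1}^Kv_a\frac{(\mu_a-\lambda_a)^2}{2}=\sup_{v\in\Sigma_K}\frac12\min_{a\ne a^*}\frac{v_{a^*}v_a}{v_{a^*}+v_a}(\mu_{a^*}-\mu_a)^2,$$ and the optimal weight vector $w(\mu)\in\Sigma_K$ is the unique maximizer $v$. The function $\phi_\mu$ is convex and strictly decreasing on $(1/\Delta_{\min}^2,+\infty)$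 and has a unique root there. *)

(* Defs.v *)
From mathcomp Require Import all_boot all_order all_algebra.
From mathcomp Require Import boolp classical_sets reals.

Set Implicit Arguments.
Unset Strict Implicit.
Unset Printing Implicit Defensive.

Import Order.TTheory GRing.Theory Num.Theory.

Local Open Scope classical_set_scope.
Local Open Scope ring_scope.

Section BestArm.
Variables (R : realType) (K : nat).
Implicit Types (mu lambda v : 'rV[R]_K) (a b : 'I_K).

Definition best_arm mu a : Prop := unique (fun b => forall c, mu 0 c <= mu 0 b) a.

Definition Gstar : set 'rV[R]_K :=
  [set mu : 'rV[R]_K | (forall a, 0 <= mu 0 a <= 1) /\ exists a, best_arm mu a].

Definition simplex : set 'rV[R]_K :=
  [set v : 'rV[R]_K | (forall a, 0 <= v 0 a <= 1) /\ \sum_a v 0 a = 1].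

Definition alternatives mu : set 'rV[R]_K :=
  [set lambda : 'rV[R]_K | Gstar lambda /\
     exists a b, [/\ best_arm mu a, best_arm lambda b & b != a]].

(* For mu in Gstar, v in simplex and 2 <= K, this set of reals is nonempty and
   bounded below by 0, so that the real-valued inf is the genuine infimum;
   likewise for the sup in char_time, since rate mu v lies in [0, 1/2]. *)
Definition rate mu v : R :=
  inf [set \sum_a v 0 a * ((mu 0 a - lambda 0 a) ^+ 2 / 2)
      | lambda in alternatives mu].

Definition char_time mu : R := (sup [set rate mu v | v in simplex])^-1.

Definition rate_maximizer mu v : Prop :=
  simplex v /\ forall u, simplex u -> rate mu u <= rate mu v.

(* The default value 0 is not in simplex: it is returned only if there is no
   unique maximizer. *)
Definition opt_weights mu : 'rV[R]_K := xget 0 [set v | unique (rate_maximizer mu) v].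

(* In the definitions below, a is the best arm of mu. *)
Definition gap mu a b : R := mu 0 a - mu 0 b.

(* The gaps of an instance in [0, 1]^K are at most 1, hence the neutral element
   1 does not affect the minimum. *)
Definition gap_min mu a : R := \big[Num.min/1]_(b | b != a) gap mu a b.

Definition phi mu a (r : R) : R :=
  \sum_(b | b != a) ((r * gap mu a b ^+ 2 - 1) ^+ 2)^-1 - 1.

End BestArm.

(* Main.v *)
(* Saddle-point certificate. Write y_b = r Delta_b^2 - 1 > 0 and let w be the
   claimed weight vector. Under w, Cauchy-Schwarz shows that raising any arm b
   above a* costs at least w_{a*} / (2r). Conversely, for any weights v, moving
   a* and b to their common w-mean bounds the rate of v by
   (v_{a*} + v_b y_b^2) / (2 r^2 Delta_b^2); averaging these bounds over b with
   weights Delta_b^2 / y_b^2 and using sum_b 1 / y_b^2 = 1 gives w_{a*} / (2r).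
   In the equality case all these bounds are tight and the common mean must be
   optimal for v too, i.e. v_{a*} = v_b y_b, which forces v = w. *)

Require Import Defs.
From mathcomp Require Import all_boot all_order all_algebra.
From mathcomp Require Import boolp classical_sets reals.
From mathcomp Require Import ring lra.

Import Order.TTheory GRing.Theory Num.Theory.

Local Open Scope ring_scope.

(** * Upper bounds on the rate from single points, ties included *)

Section TransportCost.
Set Implicit Arguments.
Unset Strict Implicit.
Variables (R : realType) (K : nat).
Implicit Types (mu lambda v : 'rV[R]_K) (a b c : 'I_K).

Definition transport_cost mu v lambda : R :=
  \sum_c v 0 c * ((mu 0 c - lambda 0 c) ^+ 2 / 2).

Lemma transport_cost_ge0 mu v lambda :
  simplex v -> 0 <= transport_cost mu v lambda.
Proof.
move=> [v01 _]; apply: sumr_ge0 => c _.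
by rewrite mulr_ge0 ?divr_ge0 ?sqr_ge0//; case/andP: (v01 c).
Qed.

Lemma transport_cost_ge_pair mu v lambda a b : simplex v -> b != a ->
  v 0 a * ((mu 0 a - lambda 0 a) ^+ 2 / 2) +
  v 0 b * ((mu 0 b - lambda 0 b) ^+ 2 / 2) <= transport_cost mu v lambda.
Proof.
move=> [v01 _] ba; rewrite /transport_cost (bigD1 a)//= (bigD1 b)//=.
rewrite lerD2l lerDl sumr_ge0// => c _.
by rewrite mulr_ge0 ?divr_ge0 ?sqr_ge0//; case/andP: (v01 c).
Qed.

Lemma rate_le_alternative mu v lambda :
  simplex v -> alternatives mu lambda -> rate mu v <= transport_cost mu v lambda.
Proof.
move=> sv alt; apply: ge_inf; last by exists lambda.
by exists 0 => _ [l _ <-]; exact: transport_cost_ge0.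
Qed.

(* [lambda] is only a limit of alternatives: push it towards the vertex of its
   best arm other than [a]; the cost is convex along this segment. *)
Lemma rate_le_transport_cost mu v lambda a b :
  simplex v -> best_arm mu a -> b != a ->
  (forall c, 0 <= lambda 0 c <= 1) -> lambda 0 a <= lambda 0 b ->
  rate mu v <= transport_cost mu v lambda.
Proof.
move=> sv hmu ba l01 lab.
(* A maximizer [d] over the arms other than [a] is a global one, since [b] already dominates [a]. *)
have [d da dmax] : exists2 d, d != a & forall c, lambda 0 c <= lambda 0 d.
  case: (@arg_maxP _ _ _ b (fun c => c != a) (fun c => lambda 0 c)) => // d da dmax.
  exists d => // c; have [->|ca] := eqVneq c a; last exact: dmax.
  exact: le_trans lab (dmax b ba).
pose e : 'rV[R]_K := delta_mx 0 d.
have step t : 0 < t -> t <= 1 ->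
    rate mu v <= transport_cost mu v lambda + t * transport_cost mu v e.
  move=> t0 t1; pose l := (1 - t) *: lambda + t *: e.
  have lE c : l 0 c = (1 - t) * lambda 0 c + t * (c == d)%:R.
    by rewrite !mxE eqxx.
  have lbest : best_arm l d.
    split=> [c|c cmax]; rewrite ?lE.
      rewrite eqxx lerD ?ler_wpM2l ?subr_ge0 ?(ltW t0)//.
      by case: eqP => _; rewrite ?lexx ?ler01.
    apply/eqP; rewrite eq_sym; apply/negPn/negP => /negbTE cd.
    have := cmax d; rewrite !lE cd eqxx.
    have : (1 - t) * lambda 0 c <= (1 - t) * lambda 0 d.
      by rewrite ler_wpM2l ?subr_ge0.
    by rewrite mulr1 mulr0; lra.
  have lalt : alternatives mu l.
    split; last by exists a, d.
    split; last by exists d.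
    move=> c; rewrite lE; have /andP[x0 x1] := l01 c.
    have : 0 <= (1 - t) * lambda 0 c by rewrite mulr_ge0 ?subr_ge0.
    have : 0 <= (1 - t) * (1 - lambda 0 c) by rewrite mulr_ge0 ?subr_ge0.
    by case: (c == d); rewrite ?mulr1 ?mulr0; lra.
  apply: (le_trans (rate_le_alternative sv lalt)).
  rewrite /transport_cost mulr_sumr -big_split/=; apply: ler_sum => c _.
  have v0 : 0 <= v 0 c by case: sv => v01 _; case/andP: (v01 c).
  rewrite lE [e 0 c]mxE eqxx/= (mulrCA t) -mulrDr ler_wpM2l//.
  move: (mu 0 c) (lambda 0 c) (c == d)%:R => m x y.
  (* The first term is the convexity defect of the square; the second allows dropping the factor
     [1 - t] before [(m - x) ^+ 2]. *)
  have : 0 <= (1 - t) * (t * (x - y) ^+ 2).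
    by apply: mulr_ge0; [lra | apply: mulr_ge0; [exact: ltW | exact: sqr_ge0]].
  have : 0 <= t * (m - x) ^+ 2 by rewrite mulr_ge0 ?sqr_ge0 ?(ltW t0).
  by rewrite !expr2; lra.
rewrite leNgt; apply/negP => lt.
have C0 := transport_cost_ge0 mu e sv.
move: lt C0 step; set A := transport_cost _ _ lambda.
set C := transport_cost _ _ e; set B := rate mu v => AB C0 step.
have D0 : 0 < B - A + C + 1 by lra.
(* This [t] is in (0, 1] and satisfies [t * C < B - A], contradicting [step]. *)
have := step ((B - A) / (B - A + C + 1)).
rewrite divr_gt0 ?subr_gt0// ler_pdivrMr// => /(_ isT).
rewrite -lerBlDl mulrAC ler_pdivlMr// => H.
have {}H := H ltac:(lra).
have : 0 < (B - A) * (B - A + 1) by apply: mulr_gt0; lra.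
by nra.
Qed.

(** Putting both arms at the level [m] creates a tie, and only these two arms contribute to the
    cost. *)
Lemma rate_le_pair mu v a b m : Gstar mu -> simplex v -> best_arm mu a ->
  b != a -> mu 0 b <= m <= mu 0 a ->
  rate mu v <= (v 0 a * (mu 0 a - m) ^+ 2 + v 0 b * (mu 0 b - m) ^+ 2) / 2.
Proof.
move=> [mu01 _] sv hmu ba /andP[bm ma].
pose l : 'rV[R]_K := \row_c if (c == a) || (c == b) then m else mu 0 c.
have := @rate_le_transport_cost mu v l a b sv hmu ba.
rewrite /transport_cost (bigD1 a)//= (bigD1 b)//= big1 => [|c /andP[ca cb]]; last first.
  by rewrite mxE (negbTE ca) (negbTE cb) subrr expr0n/= mul0r mulr0.
rewrite !mxE !eqxx orbT/= addr0 !mulrA -mulrDl; apply=> // c.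
rewrite mxE; case: ifP => // _.
by have := mu01 a; have := mu01 b; lra.
Qed.

End TransportCost.

(** * Weights built from the root: optimality and uniqueness *)

Section OptimalWeights.
Set Implicit Arguments.
Unset Strict Implicit.
Variables (R : realType) (K : nat) (mu : 'rV[R]_K) (a : 'I_K) (r : R).
Hypotheses (hmu : Gstar mu) (ha : best_arm mu a).
Hypotheses (hr : 1 / gap_min mu a ^+ 2 < r) (hphi : phi mu a r = 0).

Local Notation g b := (gap mu a b).
Local Notation y b := (r * gap mu a b ^+ 2 - 1).

Lemma gap_gt0 b : b != a -> 0 < g b.
Proof.
move=> ba; rewrite subr_gt0 ltNge; apply/negP => ab.
case: ha => amax auniq; move/eqP: ba; apply; apply/esym/auniq => c.
exact: le_trans (amax c) ab.
Qed.

Lemma gap_min_gt0 : 0 < gap_min mu a.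
Proof. by apply: lt_bigmin => // b; exact: gap_gt0. Qed.

Lemma root_gt0 : 0 < r.
Proof. by apply: lt_trans hr; rewrite divr_gt0 ?exprn_gt0 ?gap_min_gt0. Qed.

Lemma excess_gt0 b : b != a -> 0 < y b.
Proof.
move=> ba; have m0 := gap_min_gt0; rewrite subr_gt0.
have mg : gap_min mu a <= g b by exact: bigmin_le_cond.
move: hr; rewrite ltr_pdivrMr ?exprn_gt0// => /lt_le_trans; apply.
have g0 : 0 <= g b by exact: ltW (gap_gt0 ba).
by rewrite ler_wpM2l ?(ltW root_gt0)// lerXn2r ?nnegrE ?(ltW m0).
Qed.

Lemma sum_inv_sqr_excess : \sum_(b | b != a) (y b ^+ 2)^-1 = 1.
Proof. by apply/eqP; rewrite -subr_eq0; apply/eqP. Qed.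

Definition root_weight : R := 1 / (1 + \sum_(b | b != a) 1 / y b).

Definition root_weights : 'rV[R]_K :=
  \row_b (if b == a then root_weight else root_weight / y b).

Lemma root_weight_den_gt0 : 0 < 1 + \sum_(b | b != a) 1 / y b.
Proof.
rewrite ltr_pwDl// sumr_ge0// => b ba.
by rewrite divr_ge0// ltW// excess_gt0.
Qed.

Lemma root_weight_gt0 : 0 < root_weight.
Proof. by rewrite divr_gt0// root_weight_den_gt0. Qed.

Lemma root_weights_best : root_weights 0 a = root_weight.
Proof. by rewrite mxE eqxx. Qed.

Lemma root_weights_other b : b != a -> root_weights 0 b = root_weight / y b.
Proof. by rewrite mxE => /negbTE ->. Qed.

Lemma simplex_root_weights : simplex root_weights.
Proof.
have w0 b : 0 <= root_weights 0 b.
  have [->|ba] := eqVneq b a; first by rewrite root_weights_best ltW// root_weight_gt0.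
  by rewrite root_weights_other// divr_ge0 ?ltW ?excess_gt0 ?root_weight_gt0.
have w1 : \sum_b root_weights 0 b = 1.
  rewrite (bigD1 a)//= root_weights_best.
  under eq_bigr => b ba do rewrite root_weights_other// -[_^-1]div1r.
  rewrite -mulr_sumr -[X in X + _]mulr1 -mulrDr /root_weight divfK//.
  by rewrite gt_eqF// root_weight_den_gt0.
split=> // b; rewrite w0/= -w1 (bigD1 b)//= lerDl sumr_ge0//.
Qed.

(** An empty sum could not equal 1 in [sum_inv_sqr_excess]. *)
Lemma exists_other_arm : exists b, b != a.
Proof.
case: (pselect (exists b, b != a)) => // none.
move/eqP: sum_inv_sqr_excess; rewrite big1 ?[_ == 1]eq_sym ?oner_eq0// => b ba.
by case: none; exists b.
Qed.

Lemma alternatives_nonempty : exists lambda, alternatives mu lambda.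
Proof.
have [b ba] := exists_other_arm.
pose e : 'rV[R]_K := delta_mx 0 b.
have eE c : e 0 c = (c == b)%:R by rewrite mxE eqxx.
have eb : best_arm e b.
  split=> [c|c cmax]; first by rewrite !eE eqxx; case: eqP.
  have := cmax b; rewrite !eE eqxx; case: eqVneq => //= _.
  by rewrite ler10.
exists e; split; last by exists a, b.
split; last by exists b.
by move=> c; rewrite eE; case: eqP => _; rewrite ?lexx ?ler01.
Qed.

(* With [v = root_weights], all the constraints [lambda_b >= lambda_a] are
   equally expensive to meet. *)
Lemma rate_root_weights_ge : root_weight / (2 * r) <= rate mu root_weights.
Proof.
apply: lb_le_inf.
  by have [l hl] := alternatives_nonempty; exists (transport_cost mu root_weights l), l.
move=> _ [l [_ [a' [b [ha' hb ba']]]] <-].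
have aa' : a' = a by case: ha' => amax /(_ a); apply; case: ha.
rewrite {}aa' in ba' ha'.
apply: le_trans (transport_cost_ge_pair mu l simplex_root_weights ba').
rewrite root_weights_best root_weights_other//.
have lab : l 0 a <= l 0 b by case: hb.
have y0 := excess_gt0 ba'; have r0 := root_gt0; have g0 := gap_gt0 ba'.
have w0 := root_weight_gt0; have yE : r * g b ^+ 2 = y b + 1 by ring.
move: y0 yE g0; set Y := y b => y0 yE; set D := g b => g0.
set p := mu 0 a - l 0 a; set q := mu 0 b - l 0 b.
have pq : D <= p - q by rewrite /D /p /q /gap; lra.
have sq : D ^+ 2 <= (p - q) ^+ 2 by rewrite lerXn2r ?nnegrE//; lra.
(* Cauchy-Schwarz with weights 1 and [1 / Y], whose inverses add up to [Y + 1 = r * D ^+ 2]. *)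
have CS : (p - q) ^+ 2 <= (p ^+ 2 + q ^+ 2 / Y) * (Y + 1).
  rewrite -subr_ge0.
  have -> : (p ^+ 2 + q ^+ 2 / Y) * (Y + 1) - (p - q) ^+ 2 =
    (p * Y + q) ^+ 2 / Y by field; lra.
  by rewrite divr_ge0 ?sqr_ge0// ltW.
have -> : root_weight * (p ^+ 2 / 2) + root_weight / Y * (q ^+ 2 / 2) =
  root_weight / (2 * r) * (r * (p ^+ 2 + q ^+ 2 / Y)) by field; lra.
rewrite ler_pMr ?(divr_gt0 w0) ?mulr_gt0//.
rewrite -(ler_pM2r (_ : 0 < Y + 1)) ?mul1r; last by lra.
rewrite -yE -mulrA ler_pM2l// yE; exact: le_trans sq CS.
Qed.

(* Bound the rate by the alternative moving arms [a] and [b] to the common mean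
   [mu_a - 1 / (r * g b)], the weighted mean of the two under [root_weights]. *)
Lemma rate_le_crossing v b : simplex v -> b != a ->
  2 * r * (rate mu v) * (r * g b ^+ 2) <= v 0 a + v 0 b * y b ^+ 2.
Proof.
move=> sv ba; have y0 := excess_gt0 ba; have r0 := root_gt0.
have g0 := gap_gt0 ba.
have := @rate_le_pair _ _ mu v a b (mu 0 a - 1 / (r * g b)) hmu sv ha ba.
have rg : 0 < r * g b by rewrite mulr_gt0.
(* Positivity of [y b] keeps the crossing level above [mu 0 b]. *)
have i1 : 1 / (r * g b) <= g b.
  by rewrite ler_pdivrMr// mulrCA -expr2; lra.
have i0 : 0 < 1 / (r * g b) by rewrite divr_gt0.
have -> : mu 0 b <= mu 0 a - 1 / (r * g b) <= mu 0 a.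
  by move: i0 i1; rewrite /gap; move: (1 / _) => x; lra.
move=> /(_ isT).
have -> : mu 0 b - (mu 0 a - 1 / (r * g b)) = - (y b / (r * g b)).
  have -> : mu 0 b = mu 0 a - g b by rewrite /gap; ring.
  by field; rewrite !gt_eqF.
have -> : mu 0 a - (mu 0 a - 1 / (r * g b)) = 1 / (r * g b) by ring.
rewrite sqrrN.
have -> : (v 0 a * (1 / (r * g b)) ^+ 2 + v 0 b * (y b / (r * g b)) ^+ 2) / 2 =
  (v 0 a + v 0 b * y b ^+ 2) / (2 * (r * g b) ^+ 2) by field; rewrite !gt_eqF.
rewrite ler_pdivlMr ?mulr_gt0 ?exprn_gt0//.
by apply: le_trans; rewrite le_eqVlt; apply/orP; left; apply/eqP; ring.
Qed.

(** As [r * g b ^+ 2 = y b + 1], each term is [1 / y b ^+ 2 + 1 / y b], and the inverse squares sum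
    to 1. *)
Lemma sum_excess_weight :
  \sum_(b | b != a) (r * g b ^+ 2) / y b ^+ 2 = root_weight^-1.
Proof.
rewrite /root_weight div1r invrK -[X in X + _]sum_inv_sqr_excess -big_split/=.
apply: eq_bigr => b ba; have := excess_gt0 ba.
have -> : r * g b ^+ 2 = y b + 1 by ring.
by move: (y b) => Y Y0; field; rewrite gt_eqF.
Qed.

(* Averaging the bounds of [rate_le_crossing] with weights [1 / y b ^+ 2]
   makes their right-hand sides sum to the total mass of [v]. *)
Lemma sum_crossing_slack v : simplex v ->
  \sum_(b | b != a)
    (v 0 a + v 0 b * y b ^+ 2 - 2 * r * rate mu v * (r * g b ^+ 2)) / y b ^+ 2
  = 1 - 2 * r * rate mu v / root_weight.
Proof.
move=> [_ v1].
have one : \sum_(b | b != a) (v 0 a / y b ^+ 2 + v 0 b) = 1.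
  by rewrite big_split/= -mulr_sumr sum_inv_sqr_excess mulr1 -v1 [RHS](bigD1 a).
rewrite -sum_excess_weight -[X in X - _]one mulr_sumr -sumrB.
apply: eq_bigr => b ba.
by have := excess_gt0 ba; move: (y b) => Y Y0; field; rewrite gt_eqF.
Qed.

(** The slacks summed in [sum_crossing_slack] are nonnegative by [rate_le_crossing], hence so is
    their total. *)
Lemma rate_le_root_weight v : simplex v -> rate mu v <= root_weight / (2 * r).
Proof.
move=> sv; have w0 := root_weight_gt0; have r0 := root_gt0.
rewrite ler_pdivlMr ?mulr_gt0// mulrC -[leRHS]mul1r -ler_pdivrMr// -subr_ge0.
rewrite -sum_crossing_slack// sumr_ge0// => b ba.
by rewrite divr_ge0 ?sqr_ge0// subr_ge0 rate_le_crossing.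
Qed.

Lemma rate_root_weights : rate mu root_weights = root_weight / (2 * r).
Proof.
apply/le_anti; rewrite rate_root_weights_ge rate_le_root_weight//.
exact: simplex_root_weights.
Qed.

(* Equality holds in every [rate_le_crossing], so the crossing point used there
   must be the weighted mean of [mu_a] and [mu_b]. *)
Lemma rate_eq_root_weights v : simplex v ->
  rate mu v = root_weight / (2 * r) -> v = root_weights.
Proof.
move=> sv rv; have w0 := root_weight_gt0; have r0 := root_gt0.
have va0 : 0 <= v 0 a by case: sv => v01 _; case/andP: (v01 a).
have main b : b != a -> v 0 a = root_weight /\ v 0 b = root_weight / y b.
  move=> ba; have y0 := excess_gt0 ba; have g0 := gap_gt0 ba.
  have vb0 : 0 <= v 0 b by case: sv => v01 _; case/andP: (v01 b).
  have Y2 : y b ^+ 2 != 0 by rewrite gt_eqF// exprn_gt0.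
  (* At this rate the nonnegative slacks sum to 0, so each vanishes. *)
  have E : v 0 a + v 0 b * y b ^+ 2 = root_weight * (y b + 1).
    have slack0 := sum_crossing_slack sv.
    have w2 : 1 - 2 * r * rate mu v / root_weight = 0.
      by rewrite rv; field; rewrite !gt_eqF.
    rewrite w2 in slack0.
    have ge0 c : c != a -> 0 <= (v 0 a + v 0 c * y c ^+ 2 -
        2 * r * rate mu v * (r * g c ^+ 2)) / y c ^+ 2.
      by move=> ca; rewrite divr_ge0 ?sqr_ge0// subr_ge0 rate_le_crossing.
    have /eqP := psumr_eq0P ge0 slack0 ba.
    rewrite mulf_eq0 invr_eq0 (negbTE Y2) orbF subr_eq0 => /eqP ->.
    by rewrite rv; field; rewrite gt_eqF.
  have s0 : 0 < v 0 a + v 0 b.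
    rewrite lt0r addr_ge0// andbT; apply/eqP => s0.
    have [a0 b0] : v 0 a = 0 /\ v 0 b = 0 by lra.
    by move: E; rewrite a0 b0 => /eqP; rewrite mul0r addr0 eq_sym gt_eqF// mulr_gt0//; lra.
  (* The [v]-weighted mean of [mu 0 a] and [mu 0 b], the cheapest common level under [v]. *)
  pose m := mu 0 a - v 0 b / (v 0 a + v 0 b) * g b.
  have m01 : mu 0 b <= m <= mu 0 a.
    have t0 : 0 <= v 0 b / (v 0 a + v 0 b) by rewrite divr_ge0// ltW.
    have t1 : v 0 b / (v 0 a + v 0 b) <= 1 by rewrite ler_pdivrMr//; lra.
    have : v 0 b / (v 0 a + v 0 b) * g b <= g b by rewrite ler_piMl// ltW.
    have : 0 <= v 0 b / (v 0 a + v 0 b) * g b by rewrite mulr_ge0// ltW.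
    by rewrite /m; move: (_ / _ * _) => x; rewrite /gap; lra.
  have := rate_le_pair hmu sv ha ba m01.
  have -> : mu 0 b - m = - (v 0 a / (v 0 a + v 0 b) * g b).
    have -> : mu 0 b = mu 0 a - g b by rewrite /gap; ring.
    by rewrite /m; field; rewrite gt_eqF.
  have -> : mu 0 a - m = v 0 b / (v 0 a + v 0 b) * g b by rewrite /m; ring.
  rewrite sqrrN rv.
  have -> : (v 0 a * (v 0 b / (v 0 a + v 0 b) * g b) ^+ 2 +
      v 0 b * (v 0 a / (v 0 a + v 0 b) * g b) ^+ 2) / 2 =
      v 0 a * v 0 b * (r * g b ^+ 2) / (v 0 a + v 0 b) / (2 * r).
    by field; rewrite !gt_eqF.
  rewrite ler_pM2r ?invr_gt0 ?mulr_gt0// ler_pdivlMr//.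
  have -> : r * g b ^+ 2 = y b + 1 by ring.
  move: y0 E Y2; move: (y b) => Y y0 E _ H.
  (* Multiplying [H] by [Y + 1] and substituting [E] turns it into
     [(v 0 a - v 0 b * Y) ^+ 2 <= 0]. *)
  have bal : v 0 a = v 0 b * Y.
    apply/eqP; rewrite -subr_eq0 -sqrf_eq0 eq_le sqr_ge0 andbT.
    have : (root_weight * (v 0 a + v 0 b)) * (Y + 1) <=
           (v 0 a * v 0 b * (Y + 1)) * (Y + 1) by rewrite ler_pM2r//; lra.
    have -> : root_weight * (v 0 a + v 0 b) * (Y + 1) =
      (v 0 a + v 0 b * Y ^+ 2) * (v 0 a + v 0 b) by rewrite E; ring.
    rewrite -subr_ge0 -oppr_ge0; congr (0 <= _); ring.
  have va : v 0 a = root_weight.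
    apply: (mulIf (_ : Y + 1 != 0)); first by rewrite gt_eqF//; lra.
    by rewrite -E bal; ring.
  by split=> //; rewrite -va bal addrK mulfK// gt_eqF.
have [b ba] := exists_other_arm.
apply/rowP => c; have [->|ca] := eqVneq c a.
  by rewrite root_weights_best; case: (main _ ba).
by rewrite root_weights_other//; case: (main c ca).
Qed.

(** [root_weights] attains the upper bound and is alone in doing so; hence [xget] does not fall back
    on its default. *)
Lemma opt_weightsE : opt_weights mu = root_weights.
Proof.
have sw := simplex_root_weights.
have wmax : rate_maximizer mu root_weights.
  by split=> // u su; rewrite rate_root_weights rate_le_root_weight.
have uniq v : rate_maximizer mu v -> v = root_weights.
  move=> [sv vmax]; apply: rate_eq_root_weights => //.
  by apply/le_anti; rewrite rate_le_root_weight//= -rate_root_weights vmax.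
apply: xget_unique => [|v [vmax _]]; last exact: uniq.
by split=> // v /uniq.
Qed.

Lemma char_timeE : char_time mu = 2 * r / root_weight.
Proof.
rewrite /char_time -[RHS]invf_div; congr (_^-1); apply/le_anti/andP; split.
  apply: ge_sup; last by move=> _ [v sv <-]; exact: rate_le_root_weight.
  by exists (rate mu root_weights), root_weights => //; exact: simplex_root_weights.
apply: ub_le_sup.
  by exists (root_weight / (2 * r)) => _ [v sv <-]; exact: rate_le_root_weight.
by exists root_weights; [exact: simplex_root_weights|exact: rate_root_weights].
Qed.

End OptimalWeights.

Theorem proposition8 (R : realType) (K : nat) (hK : (2 <= K)%N)
    (mu : 'rV[R]_K) (hmu : Gstar mu)
    (astar : 'I_K) (hastar : best_arm mu astar)
    (r : R) (hr : 1 / gap_min mu astar ^+ 2 < r) (hphi : phi mu astar r = 0) :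
  let w := opt_weights mu in
  let T := char_time mu in
  [/\ w 0 astar =
        1 / (1 + \sum_(a | a != astar) 1 / (r * gap mu astar a ^+ 2 - 1)),
      forall a, a != astar -> w 0 a = w 0 astar / (r * gap mu astar a ^+ 2 - 1),
      T = 2 * r / w 0 astar
    & w 0 astar = Num.sqrt (\sum_(a | a != astar) w 0 a ^+ 2)].
Proof.
move=> w T; have wE : w = root_weights mu astar r by exact: opt_weightsE.
have wbest : w 0 astar = root_weight mu astar r.
  by rewrite wE root_weights_best.
have wother a : a != astar ->
    w 0 a = w 0 astar / (r * gap mu astar a ^+ 2 - 1).
  by move=> h; rewrite wbest wE root_weights_other.
split=> //; first by rewrite wbest; exact: char_timeE.
(* Factoring out [w 0 astar ^+ 2] leaves the sum of inverse squares, which is 1 by the root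
   equation. *)
under eq_bigr => a h do rewrite wother// expr_div_n.
rewrite -mulr_sumr sum_inv_sqr_excess// mulr1 sqrtr_sqr ger0_norm//.
by rewrite wbest ltW// root_weight_gt0.
Qed.
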